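(* Let $V$ be the eigenvector matrix of $M$, partitioned into blocks $V_{++},V_{+-},V_{-+},V_{--}$, let $P$ be the exact projection matrix, and let $P_{N_\beta}$ be the OWNS-P approximation of $P$ built from recursion parameters $\{\beta_+^j,\beta_-^j\}_{j=0}^{N_\beta-1}$, with associated diagonal matrices $F_{++}$ and $F_{--}^{-1}$ (all defined in the context). For small $\hat\epsilon>0$, set $$\epsilon \equiv \min\{\hat{\epsilon},\ \|V_{++}^{-1}V_{+-}\|^{-1/2}\|V_{--}^{-1}V_{-+}\|^{-1/2}\}.$$ If $\|F_{++}\|\,\|F_{--}^{-1}\|<\epsilon$, then $$\|P_{N_\beta}-P\|\leq \|V\|\,\|F_{++}\|\,\|F_{--}^{-1}\|\big(\|V_{++}^{-1}V_{+-}\|+\|V_{--}^{-1}V_{-+}\|\big)\|V^{-1}\|+\mathcal{O}(\epsilon^2).$$ Here $\mathcal{O}(\epsilon^2)$ denotes a term bounded by $C\epsilon^2$ for all sufficiently small $\hat\epsilon>0$, with $C$ depending only on $V$.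
   Context: $\|\cdot\|$ denotes the Euclidean vector norm and its induced matrix norm. Setting: $M=M(s)=-\tilde A^{-1}\big(sI+\sum_{j=2}^d\mathcal D_j\tilde B_j+\tilde C\big)$ is an $N\times N$ complex matrix arising from a semi-discretized first-order hyperbolic system, with $s=\eta+i\omega$ and $\tilde A=\mathrm{diag}(A_{++},A_{--})$, where $A_{++}$ ($N_+\times N_+$) and $A_{--}$ ($N_-\times N_-$) are positive and negative real diagonal matrices and $N=N_++N_-$. $M$ is assumed diagonalizable with eigenpairs $(i\alpha_k,\bm v_k)$, $k=1,\dots,N$. For fixed $\omega$, an eigenvalue $i\alpha(s)$ is right-going if $\mathrm{Im}\,\alpha(s)\to+\infty$ as $\eta\to\infty$ and left-going if $\mathrm{Im}\,\alpha(s)\to-\infty$ (Briggs' criterion). There are exactly $N_+$ right-going and $N_-$ left-going eigenvalues; they are ordered so that $i^{(+)}=\{1,\dots,N_+\}$ indexes right-going and $i^{(-)}=\{N_++1,\dots,N\}$ left-going ones. After this classification $\eta=0$ is taken. So $M=VDV^{-1}$ with $D=\mathrm{diag}(i\alpha_1,\dots,i\alpha_N)$ and $V=[V_+\ V_-]$ having columns $\bm v_k$. Write $$V=\begin{bmatrix} V_{++} & V_{+-} \\ V_{-+} & V_{--} \end{bmatrix},$$ with $V_{++}$ of size $N_+\times N_+$ and $V_{--}$ of size $N_-\times N_-$, both assumed invertible. Exact projection: $P=VEV^{-1}$, $E=\mathrm{diag}(I_{++},0)$, with $I_{++}$ the $N_+\times N_+$ identity. OWNS-P approximation: for complex recursion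 parameters $\{\beta_+^j,\beta_-^j\}_{j=0}^{N_\beta-1}$, let $F_k=\prod_{j=0}^{N_\beta-1}\frac{\alpha_k-\beta_+^j}{\alpha_k-\beta_-^j}$, let $F_{++}=\mathrm{diag}(F_k)_{k\in i^{(+)}}$ and $F_{--}^{-1}=\mathrm{diag}\Big(\prod_{j=0}^{N_\beta-1}\frac{\alpha_k-\beta_-^j}{\alpha_k-\beta_+^j}\Big)_{k\in i^{(-)}}$, where it is assumed that these are well defined (no vanishing denominators). Then $$P_{N_\beta}=VR_{N_\beta}ER_{N_\beta}^{-1}V^{-1},\qquad R_{N_\beta}=\begin{bmatrix} I_{++} & F_{++}V_{++}^{-1}V_{+-}F_{--}^{-1} \\ F_{--}^{-1}V_{--}^{-1}V_{-+}F_{++} & I_{--} \end{bmatrix}^{-1}.$$ This is the matrix form of the OWNS-P recursive filter. If $\|V_{++}^{-1}V_{+-}\|\,\|V_{--}^{-1}V_{-+}\|=0$, the second entry of the minimum defining $\epsilon$ is read as $+\infty$. *)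

(* Defs.v *)
From HB Require Import structures.
From mathcomp Require Import all_boot all_order all_algebra.
From mathcomp Require Import complex.
From mathcomp Require Import all_classical all_reals all_analysis.

Set Implicit Arguments.
Unset Strict Implicit.
Unset Printing Implicit Defensive.

Import Order.TTheory GRing.Theory Num.Theory.
Import numFieldNormedType.Exports.

Local Open Scope classical_set_scope.
Local Open Scope ring_scope.
Local Open Scope complex_scope.

Definition vnorm (R : realType) (n : nat) (x : 'cV[R[i]]_n) : R :=
  Num.sqrt (\sum_(i < n) (Normc.normc (x i 0)) ^+ 2).

(* The unit ball rather than the unit sphere, so that the set is nonempty (and
   the norm is 0) when there are no columns. *)
Definition opnorm (R : realType) (m n : nat) (A : 'M[R[i]]_(m, n)) : R :=
  sup [set vnorm (A *m x) | x in [set x : 'cV[R[i]]_n | vnorm x <= 1]].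

Section Operator.
Variables (R : realType) (Np Nm : nat).

Definition A_tilde (ap : 'rV[R]_Np) (am : 'rV[R]_Nm) : 'M[R[i]]_(Np + Nm) :=
  map_mx (real_complex R) (block_mx (diag_mx ap) 0 0 (diag_mx am)).

Definition M_op (d : nat) (ap : 'rV[R]_Np) (am : 'rV[R]_Nm)
    (D B : nat -> 'M[R[i]]_(Np + Nm)) (C : 'M[R[i]]_(Np + Nm)) (s : R[i]) :
    'M[R[i]]_(Np + Nm) :=
  - (invmx (A_tilde ap am) *m
       (s%:M + \sum_(2 <= j < d.+1) D j *m B j + C)).

(* [alpha k eta] is the k-th eigenvalue branch of [M (eta + i omega)], divided
   by i. The branches exhaust the spectrum with multiplicity for every
   eta >= 0; their continuity is what ties the labels at eta = 0 to the
   behaviour as eta -> +oo. [complex.Re] and [complex.Im] are the R-valued parts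
   (plain [Re], [Im] are R[i]-valued, from Num.Theory). Indices in the range of [lshift] are the
   right-going ones, those in the range of [rshift] the left-going ones. *)
Record briggs_branches (M : R[i] -> 'M[R[i]]_(Np + Nm)) (omega : R)
    (alpha : 'I_(Np + Nm) -> R -> R[i]) : Prop := BriggsBranches {
  branches_spectrum : forall eta : R, 0 <= eta ->
    char_poly (M (eta +i* omega)) =
    \prod_(k < Np + Nm) ('X - ('i%C * alpha k eta)%:P);
  branches_continuous : forall k : 'I_(Np + Nm),
    {within `[0, +oo[, continuous (fun eta : R => complex.Re (alpha k eta))} /\
    {within `[0, +oo[, continuous (fun eta : R => complex.Im (alpha k eta))};
  branches_right_going : forall k : 'I_Np,
    complex.Im (alpha (lshift Nm k) eta) @[eta --> +oo] --> +oo;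
  branches_left_going : forall k : 'I_Nm,
    complex.Im (alpha (rshift Np k) eta) @[eta --> +oo] --> -oo
}.

Definition E_proj : 'M[R[i]]_(Np + Nm) := block_mx 1%:M 0 0 0.

Definition P_exact (V : 'M[R[i]]_(Np + Nm)) : 'M[R[i]]_(Np + Nm) :=
  V *m E_proj *m invmx V.

(* V_{++}^{-1} V_{+-} and V_{--}^{-1} V_{-+} *)
Definition Vpm_ratio (V : 'M[R[i]]_(Np + Nm)) : 'M[R[i]]_(Np, Nm) :=
  invmx (ulsubmx V) *m ursubmx V.
Definition Vmp_ratio (V : 'M[R[i]]_(Np + Nm)) : 'M[R[i]]_(Nm, Np) :=
  invmx (drsubmx V) *m dlsubmx V.

Section Filter.
Variables (Nb : nat) (bp bm : 'I_Nb -> R[i]) (alpha : 'I_(Np + Nm) -> R[i]).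

Definition F_pp : 'M[R[i]]_Np :=
  diag_mx (\row_k \prod_(j < Nb)
    ((alpha (lshift Nm k) - bp j) / (alpha (lshift Nm k) - bm j))).

(* F_{--}^{-1}, given directly by the reciprocal products: F_{--} itself need
   not be defined. *)
Definition F_mm_inv : 'M[R[i]]_Nm :=
  diag_mx (\row_k \prod_(j < Nb)
    ((alpha (rshift Np k) - bm j) / (alpha (rshift Np k) - bp j))).

Definition F_well_defined : Prop :=
  (forall (k : 'I_Np) (j : 'I_Nb), alpha (lshift Nm k) - bm j != 0) /\
  (forall (k : 'I_Nm) (j : 'I_Nb), alpha (rshift Np k) - bp j != 0).

Definition R_owns (V : 'M[R[i]]_(Np + Nm)) : 'M[R[i]]_(Np + Nm) :=
  invmx (block_mx 1%:M (F_pp *m Vpm_ratio V *m F_mm_inv)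
                  (F_mm_inv *m Vmp_ratio V *m F_pp) 1%:M).

Definition P_owns (V : 'M[R[i]]_(Np + Nm)) : 'M[R[i]]_(Np + Nm) :=
  V *m R_owns V *m E_proj *m invmx (R_owns V) *m invmx V.
End Filter.

(* When a * b = 0 the second entry of the minimum is +oo. *)
Definition eps_owns (V : 'M[R[i]]_(Np + Nm)) (epsh : R) : R :=
  let a := opnorm (Vpm_ratio V) in
  let b := opnorm (Vmp_ratio V) in
  if a * b == 0 then epsh
  else Num.min epsh (a `^ (- 2^-1) * b `^ (- 2^-1)).

End Operator.

(* Main.v *)
(* In the eigenvector basis the OWNS-P projection is [W^-1 E W], where [W] is
   the identity plus an off-diagonal block matrix [A] with
   [|A| <= |F_++| |F_--^-1| c], [c = |V_++^-1 V_+-| + |V_--^-1 V_-+|]. For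
   small [epsilon] this is at most 1/2, so that [|W^-1| <= 2] and the expansion
   of [W^-1 E W - E] in powers of [A] has a uniformly bounded quadratic
   remainder. *)
Require Import Defs.
From mathcomp Require Import all_boot all_order all_algebra.
From mathcomp Require Import complex.
From mathcomp Require Import all_classical all_reals all_analysis.
From mathcomp Require Import ring lra.

Import Order.TTheory GRing.Theory Num.Theory.
Import numFieldNormedType.Exports.

Local Open Scope classical_set_scope.
Local Open Scope ring_scope.
Local Open Scope complex_scope.

(** * The Euclidean norm on complex column vectors *)

Section EuclideanNorm.
Set Implicit Arguments.
Unset Strict Implicit.
Variable R : realType.
Implicit Types m n : nat.

Lemma normc_ge0 (z : R[i]) : 0 <= Normc.normc z.
Proof. by case: z => x y; rewrite /Normc.normc sqrtr_ge0. Qed.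

Lemma normc_sum (I : finType) (f : I -> R[i]) :
  Normc.normc (\sum_i f i) <= \sum_i Normc.normc (f i).
Proof.
elim/big_ind2: _ => [|x a y b xa yb|//]; first by rewrite Normc.normc0.
exact: le_trans (le_normcD _ _) (lerD xa yb).
Qed.

(** Cauchy-Schwarz, as needed for the triangle inequality [vnormD]. Families of norm zero are split
    off because the main case cancels the factor [2 * (A * B)]. *)
Lemma sum_mul_le_sqrt (I : finType) (a b : I -> R) :
  \sum_i a i * b i <=
  Num.sqrt (\sum_i a i ^+ 2) * Num.sqrt (\sum_i b i ^+ 2).
Proof.
have S0 (f : I -> R) : 0 <= \sum_i f i ^+ 2.
  by apply: sumr_ge0 => i _; exact: sqr_ge0.
have null (f : I -> R) i : \sum_i f i ^+ 2 = 0 -> f i = 0.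
  move=> /eqP; rewrite psumr_eq0 => [/allP/(_ i)|j _]; last exact: sqr_ge0.
  by rewrite mem_index_enum sqrf_eq0 => /(_ isT)/eqP.
have [a0|a0] := eqVneq (\sum_i a i ^+ 2) 0.
  by rewrite a0 sqrtr0 mul0r big1// => i _; rewrite (null _ _ a0) mul0r.
have [b0|b0] := eqVneq (\sum_i b i ^+ 2) 0.
  by rewrite b0 sqrtr0 mulr0 big1// => i _; rewrite (null _ _ b0) mulr0.
set A := Num.sqrt (\sum_i a i ^+ 2); set B := Num.sqrt (\sum_i b i ^+ 2).
have A0 : 0 < A by rewrite sqrtr_gt0 lt_def a0 S0.
have B0 : 0 < B by rewrite sqrtr_gt0 lt_def b0 S0.
have A2 : \sum_i a i ^+ 2 = A ^+ 2 by rewrite sqr_sqrtr.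
have B2 : \sum_i b i ^+ 2 = B ^+ 2 by rewrite sqr_sqrtr.
have AB : 0 < 2 * (A * B) by rewrite !mulr_gt0.
rewrite -(ler_pM2l AB) mulr_sumr.
(* [2 (A B) (a_i b_i) <= (B a_i)^2 + (A b_i)^2] *)
have -> : 2 * (A * B) * (A * B) = \sum_i ((B * a i) ^+ 2 + (A * b i) ^+ 2).
  rewrite big_split/=; under eq_bigr do rewrite exprMn.
  under [X in _ + X]eq_bigr do rewrite exprMn.
  by rewrite -!mulr_sumr A2 B2; ring.
apply: ler_sum => i _; rewrite -subr_ge0.
rewrite (_ : _ - _ = (B * a i - A * b i) ^+ 2) ?sqr_ge0//; ring.
Qed.

Lemma vnorm_ge0 n (x : 'cV[R[i]]_n) : 0 <= vnorm x.
Proof. exact: sqrtr_ge0. Qed.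

Lemma sqr_vnorm n (x : 'cV[R[i]]_n) :
  vnorm x ^+ 2 = \sum_i Normc.normc (x i 0) ^+ 2.
Proof. by rewrite sqr_sqrtr ?sumr_ge0// => i _; rewrite sqr_ge0. Qed.

Lemma vnorm0 n : vnorm (0 : 'cV[R[i]]_n) = 0.
Proof.
by rewrite /vnorm big1 ?sqrtr0// => i _; rewrite mxE Normc.normc0 expr0n.
Qed.

Lemma vnormN n (x : 'cV[R[i]]_n) : vnorm (- x) = vnorm x.
Proof. by rewrite /vnorm; under eq_bigr do rewrite mxE normcN. Qed.

Lemma vnormZ n (c : R[i]) (x : 'cV[R[i]]_n) :
  vnorm (c *: x) = Normc.normc c * vnorm x.
Proof.
rewrite /vnorm; under eq_bigr do rewrite mxE Normc.normcM exprMn.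
by rewrite -mulr_sumr sqrtrM ?sqr_ge0// sqrtr_sqr ger0_norm ?normc_ge0.
Qed.

Lemma vnormD n (x y : 'cV[R[i]]_n) : vnorm (x + y) <= vnorm x + vnorm y.
Proof.
rewrite -(ler_pXn2r (_ : 0 < 2)%N) ?nnegrE ?addr_ge0 ?vnorm_ge0//.
apply: (@le_trans _ _
  (\sum_i (Normc.normc (x i 0) + Normc.normc (y i 0)) ^+ 2)).
  rewrite sqr_vnorm; apply: ler_sum => i _; rewrite mxE.
  rewrite ler_pXn2r ?nnegrE ?addr_ge0 ?normc_ge0//; exact: le_normcD.
under eq_bigr do rewrite sqrrD.
rewrite !big_split/= sqrrD -!sqr_vnorm lerD2r lerD2l mulr2n.
by rewrite lerD ?sum_mul_le_sqrt.
Qed.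

Lemma vnorm_eq0 n (x : 'cV[R[i]]_n) : vnorm x = 0 -> x = 0.
Proof.
move=> /(congr1 (fun t => t ^+ 2)); rewrite sqr_vnorm expr0n => /eqP.
rewrite psumr_eq0 => [/allP x0|i _]; last exact: sqr_ge0.
apply/matrixP => i j; rewrite ord1 mxE; apply: Normc.eq0_normc.
by have := x0 i; rewrite mem_index_enum sqrf_eq0 => /(_ isT)/eqP.
Qed.

Lemma normc_le_vnorm n (x : 'cV[R[i]]_n) i : Normc.normc (x i 0) <= vnorm x.
Proof.
rewrite -(ler_pXn2r (_ : 0 < 2)%N) ?nnegrE ?normc_ge0 ?vnorm_ge0//.
by rewrite sqr_vnorm (bigD1 i)//= lerDl sumr_ge0// => j _; exact: sqr_ge0.
Qed.

(** Crude comparison with the l^1 norm, used to see that the supremum defining [opnorm] is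
    finite. *)
Lemma vnorm_le_sum n (x : 'cV[R[i]]_n) : vnorm x <= \sum_i Normc.normc (x i 0).
Proof.
have S0 : 0 <= \sum_i Normc.normc (x i 0).
  by apply: sumr_ge0 => i _; exact: normc_ge0.
rewrite -(ler_pXn2r (_ : 0 < 2)%N) ?nnegrE ?vnorm_ge0//.
rewrite sqr_vnorm expr2 mulr_suml; apply: ler_sum => i _; rewrite expr2.
apply: ler_wpM2l; first exact: normc_ge0.
by rewrite (bigD1 i)//= lerDl sumr_ge0// => j _; exact: normc_ge0.
Qed.

Lemma sqr_vnorm_col_mx m n (x : 'cV[R[i]]_m) (y : 'cV[R[i]]_n) :
  vnorm (col_mx x y) ^+ 2 = vnorm x ^+ 2 + vnorm y ^+ 2.
Proof.
rewrite !sqr_vnorm big_split_ord/=; congr (_ + _); apply: eq_bigr => i _.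
  by rewrite col_mxEu.
by rewrite col_mxEd.
Qed.

Lemma vnorm_usubmx m n (x : 'cV[R[i]]_(m + n)) : vnorm (usubmx x) <= vnorm x.
Proof.
rewrite -(ler_pXn2r (_ : 0 < 2)%N) ?nnegrE ?vnorm_ge0//.
by rewrite -[x in leRHS]vsubmxK sqr_vnorm_col_mx lerDl sqr_ge0.
Qed.

Lemma vnorm_dsubmx m n (x : 'cV[R[i]]_(m + n)) : vnorm (dsubmx x) <= vnorm x.
Proof.
rewrite -(ler_pXn2r (_ : 0 < 2)%N) ?nnegrE ?vnorm_ge0//.
by rewrite -[x in leRHS]vsubmxK sqr_vnorm_col_mx lerDr sqr_ge0.
Qed.

Lemma vnorm_col_mx m n (x : 'cV[R[i]]_m) (y : 'cV[R[i]]_n) :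
  vnorm (col_mx x y) <= vnorm x + vnorm y.
Proof.
rewrite -(ler_pXn2r (_ : 0 < 2)%N) ?nnegrE ?addr_ge0 ?vnorm_ge0//.
by rewrite sqr_vnorm_col_mx sqrrD lerD2r lerDl mulrn_wge0// mulr_ge0 ?vnorm_ge0.
Qed.

End EuclideanNorm.

(** * The induced matrix norm and perturbations of the identity *)

Section OperatorNorm.
Set Implicit Arguments.
Unset Strict Implicit.
Variable R : realType.
Implicit Types m n p q : nat.

(** Makes the [sup] in [opnorm] a genuine least upper bound: on the unit ball every coordinate has
    modulus at most 1, so the moduli of all entries of [A] add up to a bound. *)
Lemma opnorm_has_ubound m n (A : 'M[R[i]]_(m, n)) :
  has_ubound [set vnorm (A *m x) | x in [set x : 'cV[R[i]]_n | vnorm x <= 1]].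
Proof.
exists (\sum_i \sum_j Normc.normc (A i j)) => _ [x /= x1 <-].
apply: le_trans (vnorm_le_sum _) _; apply: ler_sum => i _; rewrite mxE.
apply: le_trans (normc_sum _) _; apply: ler_sum => j _.
rewrite Normc.normcM ler_piMr ?normc_ge0//.
exact: le_trans (normc_le_vnorm _ _) x1.
Qed.

Lemma opnorm_ge0 m n (A : 'M[R[i]]_(m, n)) : 0 <= opnorm A.
Proof.
apply: ub_le_sup (opnorm_has_ubound A) _ _; exists 0 => /=; rewrite ?mulmx0 vnorm0//.
Qed.

Lemma vnorm_mulmx m n (A : 'M[R[i]]_(m, n)) x :
  vnorm (A *m x) <= opnorm A * vnorm x.
Proof.
have [x0|x0] := eqVneq (vnorm x) 0.
  by rewrite (vnorm_eq0 x0) mulmx0 !vnorm0 mulr0.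
have xgt0 : 0 < vnorm x by rewrite lt_def x0 vnorm_ge0.
have normcx : Normc.normc ((vnorm x)^-1)%:C = (vnorm x)^-1.
  by rewrite /Normc.normc/= expr0n addr0 sqrtr_sqr ger0_norm ?invr_ge0 ?vnorm_ge0.
rewrite -ler_pdivrMr// mulrC -normcx -vnormZ.
apply: ub_le_sup (opnorm_has_ubound A) _ _.
exists (((vnorm x)^-1)%:C *: x); last by rewrite -scalemxAr.
by rewrite /= vnormZ normcx mulVf.
Qed.

Lemma opnorm_le m n (A : 'M[R[i]]_(m, n)) c : 0 <= c ->
  (forall x, vnorm (A *m x) <= c * vnorm x) -> opnorm A <= c.
Proof.
move=> c0 Ac; apply: ge_sup.
  by exists (vnorm (A *m 0)), 0 => //=; rewrite vnorm0.
by move=> _ [x /= x1 <-]; apply: le_trans (Ac x) _; rewrite ler_piMr.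
Qed.

Lemma opnormM m n p (A : 'M[R[i]]_(m, n)) (B : 'M[R[i]]_(n, p)) :
  opnorm (A *m B) <= opnorm A * opnorm B.
Proof.
apply: opnorm_le => [|x]; first by rewrite mulr_ge0 ?opnorm_ge0.
rewrite -mulmxA -mulrA; apply: le_trans (vnorm_mulmx _ _) _.
by rewrite ler_wpM2l ?opnorm_ge0 ?vnorm_mulmx.
Qed.

Lemma opnormM3 m n p q
    (A : 'M[R[i]]_(m, n)) (B : 'M[R[i]]_(n, p)) (C : 'M[R[i]]_(p, q)) :
  opnorm (A *m B *m C) <= opnorm A * opnorm B * opnorm C.
Proof.
apply: le_trans (opnormM _ _) _.
exact: ler_wpM2r (opnorm_ge0 C) _ _ (opnormM A B).
Qed.

Lemma opnormB m n (A B : 'M[R[i]]_(m, n)) :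
  opnorm (A - B) <= opnorm A + opnorm B.
Proof.
apply: opnorm_le => [|x]; first by rewrite addr_ge0 ?opnorm_ge0.
rewrite mulmxBl mulrDl; apply: le_trans (vnormD _ _) _.
by rewrite vnormN lerD ?vnorm_mulmx.
Qed.

Lemma opnormN m n (A : 'M[R[i]]_(m, n)) : opnorm (- A) = opnorm A.
Proof.
have le (B : 'M[R[i]]_(m, n)) : opnorm (- B) <= opnorm B.
  by apply: opnorm_le (opnorm_ge0 _) _ => x; rewrite mulNmx vnormN vnorm_mulmx.
by apply: le_anti; rewrite (le A) -[X in opnorm X <= _](opprK A) (le (- A)).
Qed.

(** Each block acts on one half of the vector and lands in the other half. The maximum of the two
    norms would also do, but the sum is what the final estimate displays. *)
Lemma opnorm_antidiag_block m n (X : 'M[R[i]]_(m, n)) (Y : 'M[R[i]]_(n, m)) :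
  opnorm (block_mx 0 X Y 0) <= opnorm X + opnorm Y.
Proof.
apply: opnorm_le => [|z]; first by rewrite addr_ge0 ?opnorm_ge0.
rewrite -[z in leLHS]vsubmxK mul_block_col !mul0mx add0r addr0 mulrDl.
apply: le_trans (vnorm_col_mx _ _) _.
apply: lerD; apply: le_trans (vnorm_mulmx _ _) _; apply: ler_wpM2l;
  by rewrite ?opnorm_ge0 ?vnorm_usubmx ?vnorm_dsubmx.
Qed.

(** Write [x = (1 + A) x - A x] and absorb [|A x| <= |x| / 2] on the left. This lower bound gives
    both invertibility of [1 + A] and the bound on its inverse, with no Neumann series. *)
Lemma vnorm_le_add1mx n (A : 'M[R[i]]_n) x : opnorm A <= 2^-1 ->
  vnorm x <= 2 * vnorm ((1%:M + A) *m x).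
Proof.
move=> A2; have : vnorm x <= vnorm ((1%:M + A) *m x) + opnorm A * vnorm x.
  rewrite -[x in leLHS](addrK (A *m x)); apply: le_trans (vnormD _ _) _.
  by rewrite mulmxDl mul1mx vnormN lerD2l vnorm_mulmx.
have := ler_wpM2r (vnorm_ge0 x) A2; lra.
Qed.

Lemma add1mx_unit n (A : 'M[R[i]]_n) : opnorm A <= 2^-1 ->
  1%:M + A \in unitmx.
Proof.
(* [row_free] concerns row vectors, so passing to the transpose turns injectivity on columns into a
   trivial left kernel. *)
move=> A2; rewrite -unitmx_tr -row_free_unit; apply: inj_row_free => v v0.
suff : v^T = 0 by move=> /(congr1 trmx); rewrite trmxK trmx0.
apply/vnorm_eq0/eqP; rewrite eq_le vnorm_ge0 andbT.
apply: le_trans (vnorm_le_add1mx v^T A2) _.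
by rewrite -[_ *m v^T]trmxK trmx_mul trmxK v0 trmx0 vnorm0 mulr0.
Qed.

Lemma opnorm_invmx_add1mx n (A : 'M[R[i]]_n) : opnorm A <= 2^-1 ->
  opnorm (invmx (1%:M + A)) <= 2.
Proof.
move=> A2; apply: opnorm_le => // x.
by apply: le_trans (vnorm_le_add1mx _ A2) _; rewrite mulKVmx ?add1mx_unit.
Qed.

(* [W^-1 E W - E = W^-1 [E, W]] with [W = 1 + A] and [[E, W] = Z]; then
   [W^-1 Z = Z - W^-1 A Z] separates the linear term from the quadratic one. *)
Lemma opnorm_conj_proj m n
    (X : 'M[R[i]]_(m, n)) (Y : 'M[R[i]]_(n, m)) (r : R) :
  let W := block_mx 1%:M X Y 1%:M in
  opnorm X + opnorm Y <= r -> r <= 2^-1 ->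
  W \in unitmx /\
  opnorm (invmx W *m E_proj R m n *m W - E_proj R m n) <= r + 2 * r ^+ 2.
Proof.
move=> W XYr r2; pose A := block_mx 0 X Y 0; pose Z := block_mx 0 X (- Y) 0.
have WE : W = 1%:M + A.
  by rewrite scalar_mx_block add_block_mx !addr0 !add0r.
have Ar : opnorm A <= r by apply: le_trans (opnorm_antidiag_block _ _) XYr.
have Zr : opnorm Z <= r.
  by apply: le_trans (opnorm_antidiag_block _ _) _; rewrite opnormN.
have A2 := le_trans Ar r2.
have Wu : W \in unitmx by rewrite WE add1mx_unit.
split=> //.
(* [E_proj] commutes with the diagonal blocks of [W]; on the off-diagonal ones the commutator keeps
   [X] and flips the sign of [Y]. *)
have comm : E_proj R m n *m W - W *m E_proj R m n = Z.
  rewrite /E_proj !mulmx_block !mul1mx !mul0mx !mulmx0 !mulmx1 !addr0.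
  by rewrite opp_block_mx add_block_mx !subrr !oppr0 !add0r addr0.
have -> : invmx W *m E_proj R m n *m W - E_proj R m n =
          Z - invmx W *m (A *m Z).
  have AZ : A *m Z = W *m Z - Z by rewrite WE mulmxDl mul1mx addrC addKr.
  rewrite AZ (mulmxBr (invmx W)) (mulKmx Wu) subKr -comm mulmxBr mulKmx//.
  by rewrite mulmxA.
apply: le_trans (opnormB _ _) _; apply: lerD => //.
(* The factor 2 bounds the inverse of [W]; [A] and [Z] contribute one [r] each. *)
apply: le_trans (opnormM _ _) _; apply: ler_pM; rewrite ?opnorm_ge0//.
  by rewrite WE opnorm_invmx_add1mx.
rewrite expr2; apply: le_trans (opnormM A Z) _.
exact: (ler_pM (opnorm_ge0 A) (opnorm_ge0 Z) Ar Zr).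
Qed.

(** With [p], [q] the norms of the two filter matrices, the linear term is kept exactly and only the
    quadratic one is weakened through [p * q <= e]. Its coefficient is the constant [K] of the
    theorem. *)
Lemma quadratic_remainder_le (v v' p q c e : R) :
  0 <= v -> 0 <= v' -> 0 <= p * q -> p * q <= e ->
  v * (p * q * c + 2 * (p * q * c) ^+ 2) * v' <=
  v * p * q * c * v' + 2 * c ^+ 2 * v * v' * e ^+ 2.
Proof.
move=> v0 v'0 pq0 pqe.
have pqe2 : (p * q) ^+ 2 <= e ^+ 2.
  by rewrite ler_pXn2r ?nnegrE//; exact: le_trans pqe.
have := ler_wpM2l (mulr_ge0 (mulr_ge0 v0 v'0) (sqr_ge0 c)) pqe2; lra.
Qed.

End OperatorNorm.

(** * Choice of constants and transfer back from the eigenvector basis *)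

Theorem proposition2p14 (R : realType) (Np Nm : nat)
    (V : 'M[R[i]]_(Np + Nm)) :
  V \in unitmx -> ulsubmx V \in unitmx -> drsubmx V \in unitmx ->
  exists K eps0 : R, 0 < eps0 /\
  forall (d : nat) (ap : 'rV[R]_Np) (am : 'rV[R]_Nm)
    (D B : nat -> 'M[R[i]]_(Np + Nm)) (C : 'M[R[i]]_(Np + Nm))
    (omega : R) (alpha : 'I_(Np + Nm) -> R -> R[i])
    (Nb : nat) (bp bm : 'I_Nb -> R[i]) (epsh : R),
  let M := M_op d ap am D B C in
  let alpha0 := fun k => alpha k 0 in
  let Fpp := F_pp bp bm alpha0 in
  let Fmm_inv := F_mm_inv bp bm alpha0 in
  let eps := eps_owns V epsh in
  (forall k, 0 < ap 0 k) -> (forall k, am 0 k < 0) ->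
  briggs_branches M omega alpha ->
  M (0 +i* omega) = V *m diag_mx (\row_k ('i%C * alpha0 k)) *m invmx V ->
  F_well_defined bp bm alpha0 ->
  0 < epsh < eps0 ->
  opnorm Fpp * opnorm Fmm_inv < eps ->
  opnorm (P_owns bp bm alpha0 V - P_exact V) <=
    opnorm V * opnorm Fpp * opnorm Fmm_inv *
      (opnorm (Vpm_ratio V) + opnorm (Vmp_ratio V)) * opnorm (invmx V)
    + K * eps ^+ 2.
Proof.
move=> Vu _ _.
pose c := opnorm (Vpm_ratio V) + opnorm (Vmp_ratio V).
have c0 : 0 <= c by rewrite addr_ge0 ?opnorm_ge0.
(* The threshold forces [t * c <= 1/2] below, where [t] is the product of the filter norms; [c + 1]
   instead of [c] keeps it meaningful when [c = 0]. Both witnesses depend on [V] alone. *)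
exists (2 * c ^+ 2 * opnorm V * opnorm (invmx V)), (2 * (c + 1))^-1.
split; first by rewrite invr_gt0; lra.
move=> d ap am D B C omega alpha Nb bp bm epsh M alpha0 Fpp Fmm_inv eps.
move=> _ _ _ _ _ /andP[_ epsh_small] Feps.
set t := opnorm Fpp * opnorm Fmm_inv in Feps.
have t0 : 0 <= t by rewrite mulr_ge0 ?opnorm_ge0.
(* True in both branches of [eps_owns], so the hypothesis on [t] puts it below the threshold. *)
have eps_le : eps <= epsh.
  by rewrite /eps /eps_owns; case: ifP => // _; rewrite ge_min lexx.
have tc2 : t * c <= 2^-1.
  have : t <= (2 * (c + 1))^-1 by lra.
  by rewrite -[_^-1]mul1r ler_pdivlMr; lra.
pose X := Fpp *m Vpm_ratio V *m Fmm_inv.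
pose Y := Fmm_inv *m Vmp_ratio V *m Fpp.
(* [X] and [Y] carry the same two filter factors in opposite order, so both bounds contain the same
   product [t]. *)
have XYc : opnorm X + opnorm Y <= t * c.
  apply: le_trans (lerD (opnormM3 _ _ _) (opnormM3 _ _ _)) _.
  by rewrite le_eqVlt; apply/orP; left; apply/eqP; rewrite /t /c; ring.
have [Wu conjE] := opnorm_conj_proj XYc tc2.
set W := block_mx 1%:M X Y 1%:M in Wu conjE.
have -> : P_owns bp bm alpha0 V - P_exact V =
    V *m (invmx W *m E_proj R Np Nm *m W - E_proj R Np Nm) *m invmx V.
  (* [R_owns] is [invmx W] by definition, so the inverse of [R_owns] in [P_owns] is [W] itself. *)
  have -> : P_owns bp bm alpha0 V =
      V *m invmx W *m E_proj R Np Nm *m invmx (invmx W) *m invmx V by [].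
  move: (W) => W'; rewrite (invmxK W') /P_exact.
  by rewrite (mulmxBr V) mulmxBl !mulmxA.
apply: le_trans (opnormM3 _ _ _) _.
apply: le_trans (quadratic_remainder_le c (opnorm_ge0 V)
  (opnorm_ge0 (invmx V)) t0 (ltW Feps)).
exact: ler_wpM2r (opnorm_ge0 _) _ _ (ler_wpM2l (opnorm_ge0 V) conjE).
Qed.
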